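(* Let $n\ge 1$. The SOS game on a $2\times n$ board is a draw for $n<7$ and a win for the second player otherwise.
   Context: SOS game on a $2\times n$ board (2 rows, $n$ columns): the board is initially empty and two players alternately write either an S or an O in an empty cell. The first player whose move produces three consecutive cells in a line spelling SOS wins (no matter who wrote the individual letters); since there are only two rows, such a line is necessarily horizontal, i.e. contained in one of the two rows. If all cells are filled without producing SOS, the play ends in a draw. Both players are assumed to play optimally: ''a win for a player'' means that this player has a winning strategy, and ''a draw'' means that each player has a strategy guaranteeing that they do not lose. *)

(* Defs.v *)
From HB Require Import structures.
From mathcomp Require Import all_boot.

Set Implicit Arguments.
Unset Strict Implicit.
Unset Printing Implicit Defensive.

Inductive letter := LetterS | LetterO.

Definition bool_of_letter (a : letter) : bool :=
  if a is LetterS then true else false.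
Definition letter_of_bool (b : bool) : letter :=
  if b then LetterS else LetterO.
Lemma bool_of_letterK : cancel bool_of_letter letter_of_bool.
Proof. by case. Qed.
HB.instance Definition _ := Finite.copy letter (can_type bool_of_letterK).

Inductive player := First | Second.

Definition opponent (p : player) : player :=
  if p is First then Second else First.

(* (row, column) *)
Definition cell (n : nat) : finType := ('I_2 * 'I_n)%type.

Definition board (n : nat) := {ffun cell n -> option letter}.

Definition move (n : nat) : finType := (cell n * letter)%type.

Definition empty_board (n : nat) : board n := [ffun=> None].

Definition write (n : nat) (b : board n) (m : move n) : board n :=
  [ffun c => if c == m.1 then Some m.2 else b c].

(* A history lists the moves in chronological order. *)
Definition board_after (n : nat) (h : seq (move n)) : board n :=
  foldl (@write n) (empty_board n) h.

Definition has_SOS (n : nat) (b : board n) : bool :=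
  [exists r : 'I_2, exists i : 'I_n, exists j : 'I_n, exists k : 'I_n,
    [&& j == i.+1 :> nat, k == j.+1 :> nat,
        b (r, i) == Some LetterS,
        b (r, j) == Some LetterO &
        b (r, k) == Some LetterS]].

Definition is_full (n : nat) (b : board n) : bool :=
  [forall c, b c != None].

Definition game_over (n : nat) (h : seq (move n)) : bool :=
  has_SOS (board_after h) || is_full (board_after h).

Definition legal (n : nat) (h : seq (move n)) (m : move n) : bool :=
  ~~ game_over h && (board_after h m.1 == None).

Inductive play (n : nat) : seq (move n) -> Prop :=
| play_start : play [::]
| play_move h m : play h -> legal h m -> play (rcons h m).

Definition turn (n : nat) (h : seq (move n)) : player :=
  if odd (size h) then Second else First.

(* In a play, an SOS can only have been produced by the last move, made by the
   opponent of the player whose turn it would be next. *)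
Definition winner (n : nat) (h : seq (move n)) : option player :=
  if has_SOS (board_after h) then Some (opponent (turn h)) else None.

Definition strategy (n : nat) := seq (move n) -> move n.

Definition legal_strategy (n : nat) (p : player) (s : strategy n) : Prop :=
  forall h, play h -> ~~ game_over h -> turn h = p -> legal h (s h).

Definition follows (n : nat) (p : player) (s : strategy n)
    (h : seq (move n)) : Prop :=
  forall h1 m h2, h = h1 ++ m :: h2 -> turn h1 = p -> m = s h1.

(* Every play is finite, so it suffices to constrain the completed ones. *)
Definition winning_strategy (n : nat) (p : player) (s : strategy n) : Prop :=
  legal_strategy p s /\
  forall h, play h -> follows p s h -> game_over h -> winner h = Some p.

Definition nonlosing_strategy (n : nat) (p : player) (s : strategy n) : Prop :=
  legal_strategy p s /\
  forall h, play h -> follows p s h -> game_over h ->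
    winner h <> Some (opponent p).

Definition is_win_for (n : nat) (p : player) : Prop :=
  exists s : strategy n, winning_strategy p s.

Definition is_draw (n : nat) : Prop :=
  forall p : player, exists s : strategy n, nonlosing_strategy p s.

(* Main.v *)
Require Import Defs.
From mathcomp Require Import all_boot zify.

Set Implicit Arguments.
Unset Strict Implicit.
Unset Printing Implicit Defensive.

(** In a quiet position (no SOS, and none available in one move), a move that
leaves a threat loses at once, so the game is a contest of safe moves.  The
whole analysis rests on one observation, [unplayable_in_trap]: an empty cell in
which both letters are unsafe is one of the two middle cells of a trap, four
consecutive cells reading S, empty, empty, S.  Two distinct traps have disjoint
middles, so traps contain an even number of empty cells.

The board has an even number of cells, so when Second moves the number of empty
cells is odd and one of them lies outside every trap: Second always has a safe
move ([odd_safe_move]) and never loses.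

A trap survives every safe move ([trap_survives]), so once there is one the
board cannot fill up without somebody playing inside a trap, and Second never
has to.  Hence Second wins as soon as a trap exists.  When n >= 7, Second
answers the opening with an S in column 3 of the other row, which has three
columns on each side.  First's next move disturbs at most one side, and Second
puts an S three columns away on the other one ([trap_completion]).

When n <= 6, First can prevent traps altogether: a single O placed in a row
that holds at most one letter blocks all its potential traps
([blocked_by_O]).  First does so in row 0 with the opening and in row 1 with
the next move; with no traps around, every quiet position that is not full has
a safe move ([trap_free_safe_move]), so First does not lose.

Plays are handled by invariants: [careful_strategy] turns a plan, that is a
predicate on histories that can be maintained by safe moves, into a strategy. *)

(** * Rows, threats and traps *)

Notation SomeS := (Some LetterS).
Notation SomeO := (Some LetterO).

(** Each row is padded with Os from column n on.  No SOS, threat or trap can use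
such a padding cell, so these patterns can be described on functions over nat,
without bounds on the columns. *)
Definition look n (b : board n) (r : 'I_2) (k : nat) : option letter :=
  if insub k is Some i then b (r, i) else SomeO.

Definition upd (g : nat -> option letter) (c : nat) (a : letter) (k : nat) :=
  if k == c then Some a else g k.

Definition sos_at (g : nat -> option letter) i :=
  [&& g i == SomeS, g i.+1 == SomeO & g i.+2 == SomeS].

Definition threat_at (g : nat -> option letter) i :=
  [|| [&& g i == None, g i.+1 == SomeO & g i.+2 == SomeS],
      [&& g i == SomeS, g i.+1 == None & g i.+2 == SomeS] |
      [&& g i == SomeS, g i.+1 == SomeO & g i.+2 == None]].

Definition trap_at (g : nat -> option letter) i :=
  [&& g i == SomeS, g i.+1 == None, g i.+2 == None & g i.+3 == SomeS].

Definition threatened n (b : board n) :=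
  [exists r : 'I_2, exists i : 'I_n, threat_at (look b r) i].

Definition trapped n (b : board n) :=
  [exists r : 'I_2, exists i : 'I_n, trap_at (look b r) i].

Definition quiet n (b : board n) := ~~ has_SOS b && ~~ threatened b.

Definition safe n (b : board n) (m : move n) :=
  (b m.1 == None) && quiet (write b m).

Lemma look_ord n (b : board n) r (i : 'I_n) : look b r i = b (r, i).
Proof. by rewrite /look valK. Qed.

Lemma look_wall n (b : board n) r k : n <= k -> look b r k = SomeO.
Proof. by move=> le_nk; rewrite /look insubF // ltnNge le_nk. Qed.

Lemma look_inside n (b : board n) r k : look b r k != SomeO -> k < n.
Proof. by rewrite ltnNge; apply: contraNN => /look_wall ->. Qed.

Lemma look_write n (b : board n) r (c : 'I_n) a :
  look (write b (r, c, a)) r =1 upd (look b r) c a.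
Proof.
move=> k; rewrite /upd; have [le_nk|lt_kn] := leqP n k.
  rewrite !look_wall //; case: eqP => // e.
  by move: (ltn_ord c); rewrite -e ltnNge le_nk.
by rewrite -[k]/(val (Ordinal lt_kn)) !look_ord ffunE /= xpair_eqE eqxx.
Qed.

Lemma look_write_other n (b : board n) r r' (c : 'I_n) a :
  r' != r -> look (write b (r, c, a)) r' =1 look b r'.
Proof.
move=> nr k; have [le_nk|lt_kn] := leqP n k; first by rewrite !look_wall.
by rewrite -[k]/(val (Ordinal lt_kn)) !look_ord ffunE /= xpair_eqE (negPf nr).
Qed.

Lemma has_SOSP n (b : board n) :
  reflect (exists r i, sos_at (look b r) i) (has_SOS b).
Proof.
apply: (iffP existsP) => [[r /existsP[i /existsP[j /existsP[k]]]]|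
                          [r [i /and3P[s1 s2 s3]]]].
  case/and5P=> /eqP ej /eqP ek s1 s2 s3; exists r, i.
  by rewrite /sos_at -ej -ek !look_ord s1 s2.
have lt3 : i.+2 < n by apply: (@look_inside _ b r); rewrite (eqP s3).
have lt2 := ltnW lt3; have lt1 := ltnW lt2.
exists r; apply/existsP; exists (Ordinal lt1); apply/existsP.
exists (Ordinal lt2); apply/existsP; exists (Ordinal lt3).
by rewrite -!look_ord /= s1 s2 s3 !eqxx.
Qed.

Lemma threatenedP n (b : board n) :
  reflect (exists r i, threat_at (look b r) i) (threatened b).
Proof.
apply: (iffP existsP) => [[r /existsP[i]]|[r [i t]]]; first by exists r, i.
have lt : i < n.
  by apply: (@look_inside _ b r); case/or3P: t => /and3P[/eqP->].
by exists r; apply/existsP; exists (Ordinal lt).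
Qed.

Lemma trappedP n (b : board n) :
  reflect (exists r i, trap_at (look b r) i) (trapped b).
Proof.
apply: (iffP existsP) => [[r /existsP[i]]|[r [i t]]]; first by exists r, i.
have lt : i < n by apply: (@look_inside _ b r); case/and4P: t => /eqP->.
by exists r; apply/existsP; exists (Ordinal lt).
Qed.

Lemma eq_sos_at g g' i : g =1 g' -> sos_at g i = sos_at g' i.
Proof. by move=> e; rewrite /sos_at !e. Qed.

Lemma eq_threat_at g g' i : g =1 g' -> threat_at g i = threat_at g' i.
Proof. by move=> e; rewrite /threat_at !e. Qed.

Lemma eq_trap_at g g' i : g =1 g' -> trap_at g i = trap_at g' i.
Proof. by move=> e; rewrite /trap_at !e. Qed.

Lemma upd_eq g c a : upd g c a c = Some a.
Proof. by rewrite /upd eqxx. Qed.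

Lemma upd_neq g c a k : k != c -> upd g c a k = g k.
Proof. by rewrite /upd => /negPf->. Qed.

Lemma threatened_win n (b : board n) :
  threatened b -> exists2 m, b m.1 = None & has_SOS (write b m).
Proof.
case/threatenedP=> r [i].
have win k a : look b r k = None -> sos_at (upd (look b r) k a) i ->
    exists2 m, b m.1 = None & has_SOS (write b m).
  move=> e s; have lt : k < n by apply: (@look_inside _ b r); rewrite e.
  exists (r, Ordinal lt, a); first by rewrite -look_ord.
  by apply/has_SOSP; exists r, i; rewrite (eq_sos_at _ (look_write _ _ _ _)).
case/or3P=> /and3P[/eqP e1 /eqP e2 /eqP e3].
- by apply: (win i LetterS) => //; rewrite /sos_at upd_eq !upd_neq ?e2 ?e3 //; lia.
- by apply: (win i.+1 LetterO) => //; rewrite /sos_at upd_eq !upd_neq ?e1 ?e3 //; lia.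
- by apply: (win i.+2 LetterS) => //; rewrite /sos_at upd_eq !upd_neq ?e1 ?e2 //; lia.
Qed.

Lemma nearP i c : i <= c <= i.+2 -> [\/ c = i, c = i.+1 | c = i.+2].
Proof.
move=> H; have [->|?] := eqVneq c i; first by constructor 1.
have [->|?] := eqVneq c i.+1; first by constructor 2.
by constructor 3; lia.
Qed.

(** An SOS completed by one letter was a threat before. *)
Lemma sos_upd g c a i :
  g c = None -> sos_at (upd g c a) i -> sos_at g i || threat_at g i.
Proof.
rewrite /sos_at /threat_at => gc.
have [/nearP[] e|far] := boolP (i <= c <= i.+2); rewrite -?e.
- rewrite gc upd_eq !upd_neq; try lia.
  by case: a => // /and3P[_ -> ->]; rewrite !orbT.
- rewrite gc upd_eq !upd_neq; try lia.
  by case: a => // /and3P[-> _ ->]; rewrite !orbT.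
- rewrite gc upd_eq !upd_neq; try lia.
  by case: a => // /and3P[-> -> _]; rewrite !orbT.
- by rewrite !upd_neq; [move=> -> | lia..].
Qed.

Lemma quiet_write n (b : board n) (m : move n) :
  quiet b -> b m.1 = None -> ~~ has_SOS (write b m).
Proof.
case: m => [[r c] a] /andP[/has_SOSP ns /threatenedP nt] /= bc.
apply/has_SOSP => -[r' [i]]; have [->|ne] := eqVneq r' r; last first.
  by rewrite (eq_sos_at _ (look_write_other _ _ _ ne)) => s; apply: ns; exists r', i.
rewrite (eq_sos_at _ (look_write _ _ _ _)) => /sos_upd; rewrite look_ord bc.
by case/(_ erefl)/orP => [s|t]; [apply: ns | apply: nt]; exists r, i.
Qed.

(** * Safe moves *)

Lemma safeI n (b : board n) r (c : 'I_n) a :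
  quiet b -> b (r, c) = None ->
  (forall i, i <= c <= i.+2 -> ~~ threat_at (upd (look b r) c a) i) ->
  safe b (r, c, a).
Proof.
move=> qb bc np; rewrite /safe /= bc eqxx /quiet quiet_write //=.
case/andP: qb => _ /threatenedP nt; apply/threatenedP => -[r' [i]].
have [->|ne] := eqVneq r' r; last first.
  by rewrite (eq_threat_at _ (look_write_other _ _ _ ne)) => t; apply: nt; exists r', i.
rewrite (eq_threat_at _ (look_write _ _ _ _)).
have [near|far] := boolP (i <= c <= i.+2); first by rewrite (negPf (np _ near)).
move=> t; apply: nt; exists r, i; move: t.
by rewrite /threat_at !upd_neq //; lia.
Qed.

Lemma unsafe_near_threat n (b : board n) r (c : 'I_n) a :
  quiet b -> b (r, c) = None -> ~~ safe b (r, c, a) ->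
  exists2 i, i <= c <= i.+2 & threat_at (upd (look b r) c a) i.
Proof.
move=> qb bc us.
have [/existsP[i /andP[? ?]]|no] := boolP [exists i : 'I_c.+1,
  (i <= c <= i.+2) && threat_at (upd (look b r) c a) i].
  by exists i.
case/negP: us; apply: safeI => // i near; apply: contra no => t.
have lt : i < c.+1 by case/andP: near.
by apply/existsP; exists (Ordinal lt); rewrite near.
Qed.

(** The ways an S, and then an O, written in column c can open a threat: c must
hold its letter's place in the triple, and of the two other cells exactly one
is empty and the other is correctly filled. *)
Lemma threat_upd_S g c i : i <= c <= i.+2 -> threat_at (upd g c LetterS) i ->
  (c = i /\ (g i.+1, g i.+2) \in [:: (SomeO, None); (None, SomeS)]) \/
  (c = i.+2 /\ (g i, g i.+1) \in [:: (None, SomeO); (SomeS, None)]).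
Proof.
case/nearP=> ->; rewrite /threat_at upd_eq !upd_neq ?inE; try lia.
- move=> H; left; split=> //; move: H.
  by case: (g i.+1) (g i.+2) => [[]|] [[]|].
- by case: (g i) (g i.+2) => [[]|] [[]|].
- move=> H; right; split=> //; move: H.
  by case: (g i) (g i.+1) => [[]|] [[]|].
Qed.

Lemma threat_upd_O g c i : i <= c <= i.+2 -> threat_at (upd g c LetterO) i ->
  c = i.+1 /\ (g i, g i.+2) \in [:: (None, SomeS); (SomeS, None)].
Proof.
case/nearP=> ->; rewrite /threat_at upd_eq !upd_neq ?inE; try lia.
- by case: (g i.+1) (g i.+2) => [[]|] [[]|].
- by move=> H; split=> //; move: H; case: (g i) (g i.+2) => [[]|] [[]|].
- by case: (g i) (g i.+1) => [[]|] [[]|].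
Qed.

Lemma safe_S n (b : board n) r (c : 'I_n) :
  quiet b -> b (r, c) = None ->
  (forall i, c = i :> nat ->
     (look b r i.+1, look b r i.+2) \notin [:: (SomeO, None); (None, SomeS)]) ->
  (forall i, c = i.+2 :> nat ->
     (look b r i, look b r i.+1) \notin [:: (None, SomeO); (SomeS, None)]) ->
  safe b (r, c, LetterS).
Proof.
move=> qb bc ri le; apply: safeI => // i near; apply/negP => /(threat_upd_S near).
by case=> -[e]; [rewrite (negPf (ri _ e)) | rewrite (negPf (le _ e))].
Qed.

Lemma safe_O n (b : board n) r (c : 'I_n) :
  quiet b -> b (r, c) = None ->
  (forall i, c = i.+1 :> nat -> look b r i != SomeS /\ look b r i.+2 != SomeS) ->
  safe b (r, c, LetterO).
Proof.
move=> qb bc ns; apply: safeI => // i near; apply/negP => /(threat_upd_O near) [e].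
by have [/negPf n1 /negPf n2] := ns _ e; rewrite !inE !xpair_eqE n1 n2 andbF.
Qed.

(** An O is spoiled by an S on one side of c and an empty cell on the other
side.  The S next to c keeps an S in c from opening a threat on that side, so
the S in c is spoiled on the side of the empty cell, and then there must be an
S beyond that cell. *)
Lemma unplayable_in_trap n (b : board n) r (c : 'I_n) :
  quiet b -> b (r, c) = None -> (forall a, ~~ safe b (r, c, a)) ->
  exists2 i, trap_at (look b r) i & (c == i.+1 :> nat) || (c == i.+2 :> nat).
Proof.
move=> qb bc us; have gc : look b r c = None by rewrite look_ord.
have [i /threat_upd_S H/H{H} tS] := unsafe_near_threat qb bc (us LetterS).
have [j /threat_upd_O H/H{H} [cj tO]] := unsafe_near_threat qb bc (us LetterO).
move: gc tS tO; rewrite cj !inE !xpair_eqE => gc tS.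
case/orP=> /andP[/eqP gj /eqP gj2].
- case: tS => [[ei]|[ei]]; first by rewrite -ei gj2.
  have ej : j = i.+1 by lia.
  rewrite -ej gj orbC /= => /orP[/andP[/eqP gi _]|/andP[_ /eqP]//].
  by exists i; rewrite /trap_at -?ej ?gi ?gj ?gc ?gj2 ?eqxx ?orbT // ej.
- case: tS => [[ei]|[ei]]; last first.
    by have ej : j = i.+1 by [lia]; rewrite -ej gj /= !andbF.
  rewrite -ei gj2 /= => /eqP gj3.
  by exists j; rewrite /trap_at ?gj ?gc ?gj2 ?gj3 ?eqxx.
Qed.

Lemma trap_inside n (b : board n) r i : trap_at (look b r) i -> i.+3 < n.
Proof. by case/and4P=> _ _ _ /eqP e; apply: (@look_inside _ b r); rewrite e. Qed.

Definition shift n d (c : cell n) : cell n := (c.1, insubd c.2 (c.2 + d)).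

(** The left middles and the right middles of the traps are two disjoint images
of the set of traps under injective shifts.  If these were all the empty cells,
their number would be twice the number of traps. *)
Lemma odd_untrapped_cell n (b : board n) :
  odd #|[set c | b c == None]| ->
  exists r (c : 'I_n), b (r, c) = None /\
    forall i, trap_at (look b r) i -> c <> i.+1 :> nat /\ c <> i.+2 :> nat.
Proof.
move=> oddE; set E := [set c | b c == None] in oddE.
pose T := [set c : cell n | trap_at (look b c.1) c.2].
have val_shift d c : d < 4 -> c \in T -> (shift d c).2 = c.2 + d :> nat.
  rewrite inE => lt_d /trap_inside lt.
  by rewrite val_insubd (leq_ltn_trans _ lt) //; lia.
have card_shift d : d < 4 -> #|shift d @: T| = #|T|.
  move=> lt_d; apply: card_in_imset => -[r i] [r' i'] ti ti' e.
  have := val_shift d _ lt_d ti; rewrite e val_shift // => /addIn /ord_inj /= ei.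
  by case: e => -> _; rewrite ei.
have look_shift d c : d < 4 -> c \in T -> b (shift d c) = look b c.1 (c.2 + d).
  by move=> lt_d cT; rewrite -val_shift // look_ord.
have subE : shift 1 @: T :|: shift 2 @: T \subset E.
  apply/subsetP => c; rewrite !inE => /orP[] /imsetP[[r i] cT ->];
    rewrite look_shift //; move: cT; rewrite inE /= ?addn1 ?addn2;
    by case/and4P.
have disj : [disjoint shift 1 @: T & shift 2 @: T].
  apply/pred0P => c /=; apply: contraTF isT => /andP[/imsetP[x xT ex] /imsetP[y yT ey]].
  have e1 : x.1 = y.1 by move: ey; rewrite ex => -[].
  have e2 : x.2 + 1 = y.2 + 2 by rewrite -!val_shift // -ex -ey.
  move: xT yT; rewrite !inE => /and4P[/eqP gx _ _ _] /and4P[_ + _ _].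
  by rewrite -e1 (_ : y.2.+1 = x.2) ?gx //; lia.
have [c cE cT] : exists2 c, c \in E & c \notin shift 1 @: T :|: shift 2 @: T.
  apply/subsetPn; apply: contraL oddE => sub.
  have -> : E = shift 1 @: T :|: shift 2 @: T by apply/eqP; rewrite eqEsubset sub.
  have := disj; rewrite -setI_eq0 => /eqP d0.
  by rewrite cardsU d0 cards0 subn0 !card_shift // addnn odd_double.
case: c cE cT => r c; rewrite !inE => /eqP bc nT; exists r, c; split=> // i ti.
have lt : i < n by apply: leq_trans (trap_inside ti); lia.
have iT : (r, Ordinal lt) \in T by rewrite inE.
split=> e; case/negP: nT; apply/orP; [left|right]; apply/imsetP;
  exists (r, Ordinal lt) => //; rewrite [shift _ _]surjective_pairing; congr (_, _);
  by apply/val_inj; rewrite /= e -/(val (insubd _ _)) (val_shift _ _ _ iT) //=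
    ?addn1 ?addn2.
Qed.

Lemma untrapped_playable n (b : board n) r (c : 'I_n) :
  quiet b -> b (r, c) = None ->
  (forall i, trap_at (look b r) i -> c <> i.+1 :> nat /\ c <> i.+2 :> nat) ->
  exists m, safe b m.
Proof.
move=> qb bc nt.
have [?|nS] := boolP (safe b (r, c, LetterS)); first by exists (r, c, LetterS).
have [?|nO] := boolP (safe b (r, c, LetterO)); first by exists (r, c, LetterO).
have [|i /nt[? ?] /orP[] /eqP] // := @unplayable_in_trap _ b r c qb bc.
by case.
Qed.

Lemma odd_safe_move n (b : board n) :
  quiet b -> odd #|[set c | b c == None]| -> exists m, safe b m.
Proof.
by move=> qb /odd_untrapped_cell[r [c [bc nt]]]; apply: untrapped_playable nt.
Qed.

Lemma trap_free_safe_move n (b : board n) :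
  quiet b -> ~~ is_full b -> ~~ trapped b -> exists m, safe b m.
Proof.
move=> qb; rewrite negb_forall => /existsP[[r c]].
rewrite negbK => /eqP bc /trappedP nt.
by apply: (untrapped_playable qb bc) => i ti; case: nt; exists r, i.
Qed.

(** Either letter written in a middle cell of a trap makes a threat with the
other middle cell. *)
Lemma trap_survives n (b : board n) (m : move n) :
  b m.1 = None -> trapped b -> trapped (write b m) || threatened (write b m).
Proof.
case: m => [[r c] a] /= bc /trappedP[r' [i ti]]; apply/orP.
have [er|ne] := eqVneq r' r; last first.
  left; apply/trappedP; exists r', i.
  by rewrite (eq_trap_at _ (look_write_other _ _ _ ne)).
rewrite {r'}er in ti; have := ti.
rewrite /trap_at => /and4P[/eqP g0 /eqP g1 /eqP g2 /eqP g3].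
have gc : look b r c = None by rewrite look_ord.
have n0 : i != c by apply/eqP => e; rewrite -e g0 in gc.
have n3 : i.+3 != c by apply/eqP => e; rewrite -e g3 in gc.
have [e1|n1] := eqVneq (c : nat) i.+1.
  right; apply/threatenedP; exists r; case: a; [exists i.+1 | exists i];
    rewrite (eq_threat_at _ (look_write _ _ _ _)) /threat_at e1 upd_eq !upd_neq
      ?g0 ?g2 ?g3 ?eqxx ?orbT //; lia.
have [e2|n2] := eqVneq (c : nat) i.+2.
  right; apply/threatenedP; exists r; case: a; [exists i | exists i.+1];
    rewrite (eq_threat_at _ (look_write _ _ _ _)) /threat_at e2 upd_eq !upd_neq
      ?g0 ?g1 ?g3 ?eqxx ?orbT //; lia.
left; apply/trappedP; exists r, i; rewrite (eq_trap_at _ (look_write _ _ _ _)).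
by rewrite /trap_at !upd_neq ?g0 ?g1 ?g2 ?g3 //; rewrite eq_sym.
Qed.

Lemma board_after_rcons n (h : seq (move n)) m :
  board_after (rcons h m) = write (board_after h) m.
Proof. exact: foldl_rcons. Qed.

Lemma look_empty n r k : look (empty_board n) r k = if k < n then None else SomeO.
Proof.
case: ltnP => [lt|]; last exact: look_wall.
by rewrite -[k]/(val (Ordinal lt)) look_ord ffunE.
Qed.

Lemma quiet_empty n : quiet (empty_board n).
Proof.
apply/andP; split; [apply/has_SOSP|apply/threatenedP] => -[r [i]];
  rewrite /sos_at /threat_at !look_empty; first by case: ifP.
by do 3!case: ifP.
Qed.

Lemma card_empty_cells n (h : seq (move n)) :
  play h -> size h + #|[set c | board_after h c == None]| = 2 * n.
Proof.
elim=> [|{}h m _ IH /andP[_ /eqP bm]].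
  have -> : 2 * n = #|[set: cell n]| by rewrite cardsT card_prod !card_ord.
  by rewrite add0n; congr #|pred_of_set _|; apply/setP => c; rewrite !inE ffunE.
rewrite -IH size_rcons board_after_rcons addSnnS; congr (_ + _).
rewrite [RHS](cardsD1 m.1) !inE bm eqxx add1n; congr _.+1.
by apply: eq_card => c; rewrite !inE ffunE; case: (c == m.1).
Qed.

(** * From plans to strategies *)

Definition to_move (p : player) n (h : seq (move n)) :=
  odd (size h) == (if p is Second then true else false).

Lemma to_moveP p n (h : seq (move n)) : reflect (turn h = p) (to_move p h).
Proof. by rewrite /to_move /turn; case: (odd _); case: p; constructor. Qed.

Lemma to_move_rcons p n (h : seq (move n)) m : to_move p (rcons h m) = ~~ to_move p h.
Proof. by rewrite /to_move size_rcons /=; case: (odd _); case: p. Qed.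

(** The strategy picks a legal move preserving J when there is one, and any legal
move otherwise; the latter matters only to histories that the strategy does not
reach, where it must still be legal. *)
Lemma invariant_strategy n (hn : 0 < n) p (J : pred (seq (move n))) :
  J [::] ->
  (forall h m, J h -> ~~ to_move p h -> legal h m -> J (rcons h m)) ->
  (forall h, play h -> J h -> to_move p h -> ~~ game_over h ->
     exists2 m, legal h m & J (rcons h m)) ->
  exists s : strategy n, legal_strategy p s /\
    forall h, play h -> follows p s h -> J h.
Proof.
move=> J0 Jopp Jown.
pose m0 : move n := (ord0, Ordinal hn, LetterS).
pose s (h : seq (move n)) := odflt (odflt m0 [pick m | legal h m])
  [pick m | legal h m && J (rcons h m)].
exists s; split=> [h _ no _|h].
  rewrite /s; case: (pickP (fun m => legal h m && _)) => [m /andP[]//|_] /=.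
  case: pickP => [//|none] /=.
  have /norP[_] := no; rewrite negb_forall => /existsP[c]; rewrite negbK => ec.
  by have := none (c, LetterS); rewrite /legal no ec.
elim=> // {}h m ph IH lm fol.
have Jh : J h.
  by apply: IH => h1 x h2 e; apply: (fol h1 x (rcons h2 m)); rewrite e rcons_cat.
have [mine|] := boolP (to_move p h); last by move=> ?; apply: Jopp.
have -> : m = s h by apply: (fol h m [::]); [rewrite cats1 | apply/to_moveP].
have [|x lx Jx] := Jown h ph Jh mine; first by case/andP: lm.
rewrite /s; case: (pickP (fun m => legal h m && _)) => [y /andP[]//|/(_ x)].
by rewrite lx Jx.
Qed.

(** What p maintains: any SOS was made by p, and until then p never hands over a
threatened position and follows the plan K. *)
Definition on_course (p : player) n (K : pred (seq (move n))) (h : seq (move n)) :=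
  if has_SOS (board_after h) then ~~ to_move p h
  else (to_move p h || ~~ threatened (board_after h)) && K h.

(** Threats are cashed in at once, so the plan K only has to be carried out by
safe moves in quiet positions. *)
Lemma careful_strategy n (hn : 0 < n) p (K : pred (seq (move n))) :
  K [::] ->
  (forall h m, K h -> ~~ to_move p h -> quiet (board_after h) ->
     legal h m -> K (rcons h m)) ->
  (forall h, play h -> K h -> to_move p h -> ~~ game_over h ->
     quiet (board_after h) ->
     exists2 m, safe (board_after h) m & K (rcons h m)) ->
  exists s : strategy n, legal_strategy p s /\
    forall h, play h -> follows p s h -> on_course p K h.
Proof.
move=> K0 Kopp Kown.
apply: invariant_strategy => // [|h m Jh theirs lm|h ph Jh mine no].
- by rewrite /on_course K0; case/andP: (quiet_empty n) => /negPf-> ->; rewrite orbT.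
- have /andP[no /eqP bm] := lm; have /norP[ns _] := no.
  move: Jh; rewrite /on_course (negPf ns) (negPf theirs) /= => /andP[nt Kh].
  have qh : quiet (board_after h) by rewrite /quiet ns.
  rewrite board_after_rcons (negPf (quiet_write qh bm)) to_move_rcons theirs /=.
  exact: Kopp.
- have /norP[ns _] := no; move: Jh; rewrite /on_course (negPf ns) mine /= => Kh.
  have [/threatened_win[m bm sm]|nt] := boolP (threatened (board_after h)).
    exists m; first by rewrite /legal no bm.
    by rewrite board_after_rcons sm to_move_rcons mine.
  have [|m /andP[/eqP bm /andP[ns' nt']] Km] := Kown h ph Kh mine no.
    by rewrite /quiet ns.
  exists m; first by rewrite /legal no bm.
  by rewrite board_after_rcons (negPf ns') nt' orbT.
Qed.

Lemma on_course_winner p n K (h : seq (move n)) :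
  on_course p K h -> has_SOS (board_after h) -> winner h = Some p.
Proof.
by rewrite /on_course /winner /to_move /turn => /[swap] ->; case: odd; case: p.
Qed.

Lemma careful_nonlosing n p (K : pred (seq (move n))) :
  (exists s : strategy n, legal_strategy p s /\
    forall h, play h -> follows p s h -> on_course p K h) ->
  exists s : strategy n, nonlosing_strategy p s.
Proof.
case=> s [ls gs]; exists s; split=> // h ph fh _.
have gh := gs h ph fh; have [sh|nsh] := boolP (has_SOS (board_after h)).
  by rewrite (on_course_winner gh sh); case: (p).
by rewrite /winner (negPf nsh).
Qed.

Lemma odd_empty_cells n (h : seq (move n)) :
  play h -> to_move Second h -> odd #|[set c | board_after h c == None]|.
Proof.
move=> /card_empty_cells e; rewrite /to_move eqb_id => oh.
by have := congr1 odd e; rewrite oddD oh mul2n odd_double => /negbFE.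
Qed.

Lemma second_nonlosing n (hn : 0 < n) :
  exists s : strategy n, nonlosing_strategy Second s.
Proof.
apply: (@careful_nonlosing n Second xpredT).
apply: careful_strategy => // h ph _ mine _ qh.
by have [m sm] := odd_safe_move qh (odd_empty_cells ph mine); exists m.
Qed.

(** * Second wins on wide boards *)

Definition second_reply n (m : move n) : move n :=
  (rev_ord m.1.1, insubd m.1.2 3, LetterS).

(** A threat is allowed as an alternative to the trap, since First may play in
the trap; Second then wins at once. *)
Definition second_plan n (h : seq (move n)) :=
  if h is m1 :: m2 :: t then (m2 == second_reply m1) &&
    ((1 < size t) ==> trapped (board_after h) || threatened (board_after h))
  else true.

Lemma row_cases (r : 'I_2) : r = ord0 \/ r = ord_max.
Proof. by case: r => [[|[|//]] p]; [left | right]; apply: val_inj. Qed.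

Lemma rev_ord2_neq (r : 'I_2) : rev_ord r != r.
Proof. by case: (row_cases r) => ->. Qed.

Lemma safe_second_reply n (m1 : move n) :
  quiet (board_after [:: m1]) -> safe (board_after [:: m1]) (second_reply m1).
Proof.
move=> q1.
have l3 k : look (board_after [:: m1]) (rev_ord m1.1.1) k =
    if k < n then None else SomeO.
  rewrite -(look_empty n (rev_ord m1.1.1)); case: m1 {q1} => [[r c] a].
  exact/look_write_other/rev_ord2_neq.
apply: safe_S => // [|i _|i e]; first by rewrite -look_ord l3 ltn_ord.
  by rewrite !l3; have [?|?] := ltnP i.+1 n; have [?|?] := ltnP i.+2 n => //; lia.
have lt : i.+2 < n by rewrite -e.
by rewrite !l3 !ifT //; lia.
Qed.

(** Column x holds the only letter of the row besides the S in column 3.  The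
side of column 3 opposite to x is untouched, so neither the trap nor the cells
around its new end (column 6 or column 0) allow a threat. *)
Lemma trap_completion n (b : board n) r x :
  6 < n -> quiet b -> x != 3 -> look b r 3 = SomeS ->
  (forall k, k != 3 -> k != x -> look b r k = if k < n then None else SomeO) ->
  exists2 m, safe b m & trapped (write b m).
Proof.
move=> hn qb x3 g3 g; have [lt_x3|le_3x] := ltnP x 3.
- have h6 : 6 < n by [].
  have right k : 3 < k -> look b r k = if k < n then None else SomeO.
    by move=> ?; apply: g; lia.
  exists (r, Ordinal h6, LetterS).
    apply: safe_S => //= [|i <-|i [<-]].
    + by rewrite -look_ord right //= hn.
    + by rewrite !right //; case: (ltnP 7 n) => ?; case: (ltnP 8 n) => ? //; lia.
    + by rewrite !right // !ifT //; lia.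
  apply/trappedP; exists r, 3; rewrite (eq_trap_at _ (look_write _ _ _ _)) /trap_at.
  by rewrite /upd /= g3 !right // !ifT //; lia.
- have left k : k < 3 -> look b r k = None.
    by move=> ?; rewrite g ?ifT //; lia.
  have h0 : 0 < n by lia.
  exists (r, Ordinal h0, LetterS).
    by apply: safe_S => //= [|i <-]; rewrite -?look_ord ?left.
  apply/trappedP; exists r, 0; rewrite (eq_trap_at _ (look_write _ _ _ _)) /trap_at.
  by rewrite /upd /= g3 !left.
Qed.

Lemma play_rcons n (h : seq (move n)) m : play (rcons h m) -> play h /\ legal h m.
Proof.
move E : (rcons h m) => h' ph; case: ph E => [|h0 m0 p0 l0]; first by case: (h).
by case/rcons_inj=> -> ->.
Qed.

Lemma trap_after_second_reply n (hn : 6 < n) (m1 m3 : move n) :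
  let h := [:: m1; second_reply m1; m3] in
  play h -> quiet (board_after h) ->
  exists2 m, safe (board_after h) m & trapped (write (board_after h) m).
Proof.
move=> h ph qh.
have [_ /andP[_ /eqP free3]] := @play_rcons n [:: m1; second_reply m1] m3 ph.
set r := rev_ord m1.1.1; pose b1 := board_after [:: m1].
have row1 k : look b1 r k = if k < n then None else SomeO.
  rewrite -(look_empty n r) /r /b1; case: (m1) => [[r1 c1] a1].
  exact/look_write_other/rev_ord2_neq.
pose c2 : 'I_n := insubd m1.1.2 3.
have c2E : c2 = 3 :> nat by rewrite val_insubd ifT //; lia.
pose b2 := write b1 (r, c2, LetterS).
have row2 k : look b2 r k = if k == 3 then SomeS else if k < n then None else SomeO.
  by rewrite look_write /upd c2E row1.
have -> : board_after h = write b2 m3 by [].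
have {}free3 : b2 m3.1 = None by [].
have {}qh : quiet (write b2 m3) by [].
case: m3 {ph h} => [[r3 c3] a3] /= in free3 qh *.
have [er|ne] := eqVneq r r3.
  have c3' : c3 != 3 :> nat.
    by apply/eqP => e; move: free3; rewrite -er -look_ord row2 e.
  (* First played in the row of the lone S. *)
  apply: (@trap_completion _ _ r c3) => // [|k k3 kx];
    rewrite -er look_write ?upd_neq ?row2 ?(negPf k3) //.
  by rewrite eq_sym.
(* The row is undisturbed: any column but 3 can stand for x. *)
apply: (@trap_completion _ _ r 4) => // [|k k3 _];
  by rewrite look_write_other // row2 ?(negPf k3).
Qed.

Lemma second_wins n (hn : 6 < n) : is_win_for n Second.
Proof.
have n0 : 0 < n by lia.
have [//|h m K theirs qh|h ph K mine no qh|s [ls gs]] :=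
    @careful_strategy n n0 Second (@second_plan n).
- case/andP=> _ /eqP bm; case: h => [//|m1 [//|m2 t]] in K theirs qh bm *.
  case/andP: K => e tr; rewrite -[rcons _ _]/(m1 :: m2 :: rcons t m) /second_plan e.
  rewrite -!rcons_cons board_after_rcons size_rcons ltnS.
  apply/implyP => t_gt0; apply: trap_survives => //.
  have: 1 < size t by move: theirs t_gt0; rewrite /to_move /=; lia.
  by move/(implyP tr)/orP; case/andP: qh => _ /negPf -> [].
- case: h => [//|m1 [|m2 [//|m3 [|m4 t]]]] in ph K mine no qh *.
  + exists (second_reply m1); first exact: safe_second_reply.
    by rewrite /= eqxx.
  + case/andP: K => /eqP e _; rewrite e in ph qh *.
    have [m sm tm] := trap_after_second_reply hn ph qh; exists m => //.
    rewrite -[rcons _ _]/[:: m1; _; m3; m] /second_plan eqxx.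
    by rewrite (board_after_rcons [:: m1; _; m3]) tm.
  + case/andP: K => e tr; have [m sm] := odd_safe_move qh (odd_empty_cells ph mine).
    exists m => //; rewrite -[rcons _ _]/(m1 :: m2 :: m3 :: m4 :: rcons t m).
    rewrite /second_plan e -!rcons_cons board_after_rcons.
    have /andP[/eqP bm _] := sm.
    rewrite trap_survives ?implybT //.
    by have /orP := implyP tr isT; case/andP: qh => _ /negPf -> [].
exists s; split=> // h ph fh over; have gh := gs h ph fh.
(* Without an SOS the board would be full, yet hold a trap or a threat. *)
have [sh|nsh] := boolP (has_SOS (board_after h)); first exact: on_course_winner gh sh.
have full : is_full (board_after h) by move: over; rewrite /game_over (negPf nsh).
have nlook r k : look (board_after h) r k != None.
  have [le|lt] := leqP n k; first by rewrite look_wall.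
  by rewrite -[k]/(val (Ordinal lt)) look_ord; apply: (forallP full).
have size_h : size h = 2 * n.
  rewrite -(card_empty_cells ph) (_ : [set c | _] = set0) ?cards0 ?addn0 //.
  by apply/setP => c; rewrite !inE (negPf (forallP full c)).
move: gh; rewrite /on_course (negPf nsh) => /andP[_].
case: h size_h nlook {ph fh over nsh full} => [|m1 [|m2 t]] /=; try lia.
move=> size_h nlook /andP[_ /implyP tr].
case/orP: (tr ltac:(lia)) => [/trappedP|/threatenedP] [r [i]].
  by case/and4P=> _ /eqP e; have := nlook r i.+1; rewrite e.
case/or3P=> /and3P[/eqP e1 /eqP e2 /eqP e3].
- by have := nlook r i; rewrite e1.
- by have := nlook r i.+1; rewrite e2.
- by have := nlook r i.+2; rewrite e3.
Qed.

(** * First draws on narrow boards *)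

(** A window of four cells that can never become a trap. *)
Definition blocked (g : nat -> option letter) i :=
  [|| g i == SomeO, g i.+1 != None, g i.+2 != None | g i.+3 == SomeO].

Definition row_blocked n (b : board n) r := [forall i : 'I_n, blocked (look b r) i].

Lemma row_blockedP n (b : board n) r :
  reflect (forall i, blocked (look b r) i) (row_blocked b r).
Proof.
apply: (iffP forallP) => [bl i|bl i]; last exact: bl.
have [le|lt] := leqP n i; last exact: (bl (Ordinal lt)).
by rewrite /blocked look_wall.
Qed.

Lemma blocked_upd g c a i : g c = None -> blocked g i -> blocked (upd g c a) i.
Proof.
rewrite /blocked /upd => gc; case/or4P => H.
- by case: (i =P c) => [e|_]; [rewrite e gc in H | rewrite H].
- by apply/or4P; constructor 2; case: (i.+1 =P c).
- by apply/or4P; constructor 3; case: (i.+2 =P c).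
- by apply/or4P; constructor 4; case: (i.+3 =P c) => [e|_] //; rewrite e gc in H.
Qed.

Lemma eq_blocked g g' i : g =1 g' -> blocked g i = blocked g' i.
Proof. by move=> e; rewrite /blocked !e. Qed.

(** Blocking is permanent because letters are never erased. *)
Lemma row_blocked_write n (b : board n) m r :
  b m.1 = None -> row_blocked b r -> row_blocked (write b m) r.
Proof.
case: m => [[r' c] a] /= bc /row_blockedP bl; apply/row_blockedP => i.
have [e|ne] := eqVneq r r'; last by rewrite (eq_blocked _ (look_write_other _ _ _ ne)).
rewrite e in bl *; rewrite (eq_blocked _ (look_write _ _ _ _)).
by apply: blocked_upd; rewrite ?look_ord.
Qed.

Lemma row_blocked_no_trap n (b : board n) r i :
  row_blocked b r -> ~~ trap_at (look b r) i.
Proof.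
move=> /row_blockedP /(_ i) bl.
apply/negP => /and4P[/eqP g0 /eqP g1 /eqP g2 /eqP g3].
by rewrite /blocked g0 g1 g2 g3 in bl.
Qed.

(** Column 2 when it exists; otherwise the board is too narrow for traps. *)
Definition first_opening n (hn : 0 < n) : move n :=
  (ord0, insubd (Ordinal hn) 2, LetterO).

Definition first_plan n (hn : 0 < n) (h : seq (move n)) :=
  if h is m1 :: t then
    [&& m1 == first_opening hn, row_blocked (board_after h) ord0 &
        (1 < size t) ==> row_blocked (board_after h) ord_max]
  else true.

(** Where to put an O to block a row of at most 6 columns whose only letter is in
column x.  An O in column 2 blocks the windows starting at 0 and 1, of which it
is a middle cell, and the one starting at 2, of which it is an end.  For x = 1,
an O there could be next to an S, and its mirror image, column 3, is used.  A
letter in column 2 leaves only the window starting at 2, killed by an O in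
column 5; the case x = 3 is its mirror image. *)
Definition blocking_column x :=
  if x == 1 then 3 else if x == 2 then 5 else if x == 3 then 0 else 2.

(** The O is not adjacent to the letter in column x, hence makes no threat with
it. *)
Lemma blocking_column_apart x :
  blocking_column x != x /\ ~~ (x <= (blocking_column x).+1 <= x.+2).
Proof. by case: x => [|[|[|[|x]]]]; rewrite /blocking_column /=; lia. Qed.

(** The alternative x = 0 covers an empty row: the O then goes in column 2, which
blocks the row by itself. *)
Lemma blocked_by_O g x i :
  (forall k, 6 <= k -> g k = SomeO) -> (g x != None) || (x == 0) ->
  blocked (upd g (blocking_column x) LetterO) i.
Proof.
move=> wall gx; case: i => [|[|[|i]]]; last first.
  by rewrite /blocked {4}/upd (wall i.+3.+3) // if_same eqxx !orbT.
all: rewrite /blocked /upd /blocking_column; case: x gx => [|[|[|[|x]]]] //= gx.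
all: by rewrite ?orbF in gx *; rewrite ?gx ?orbT.
Qed.

Lemma row_blocked_write_O n (b : board n) r (c : 'I_n) x :
  n <= 6 -> (look b r x != None) || (x == 0) -> c = blocking_column x :> nat ->
  row_blocked (write b (r, c, LetterO)) r.
Proof.
move=> hn gx ec; apply/row_blockedP => i; rewrite (eq_blocked _ (look_write _ _ _ _)).
by rewrite ec; apply: blocked_by_O => // k le6; apply/look_wall/(leq_trans hn).
Qed.

(** When the blocking column is off the board, the padding already plays the role
of the blocking O. *)
Lemma row_blocked_beyond n (b : board n) r x :
  n <= 6 -> (look b r x != None) || (x == 0) -> n <= blocking_column x ->
  row_blocked b r.
Proof.
move=> hn gx le; apply/row_blockedP => i.
have wall k : 6 <= k -> look b r k = SomeO by move=> ?; apply/look_wall/(leq_trans hn).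
rewrite -(eq_blocked _ (_ : upd (look b r) (blocking_column x) LetterO =1 _)).
  exact: blocked_by_O.
by move=> k; rewrite /upd; case: eqP => // ->; rewrite look_wall.
Qed.

Lemma safe_opening n (hn : 0 < n) : safe (empty_board n) (first_opening hn).
Proof.
apply: safe_O; rewrite ?ffunE //; first exact: quiet_empty.
by move=> i _; rewrite !look_empty; case: ifP; case: ifP.
Qed.

Lemma row_blocked_opening n (hn : 0 < n) :
  n <= 6 -> row_blocked (board_after [:: first_opening hn]) ord0.
Proof.
move=> n6; have [lt2|le2] := ltnP 2 n.
  by apply: (@row_blocked_write_O _ _ _ _ 0) => //; rewrite ?orbT // val_insubd lt2.
by apply: (@row_blocked_beyond _ _ _ 0) => //; rewrite orbT.
Qed.

Lemma blocking_step n (b : board n) r x :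
  n <= 6 -> quiet b -> (look b r x != None) || (x == 0) ->
  (forall k, k != x -> look b r k = if k < n then None else SomeO) ->
  (forall r', r' != r -> row_blocked b r') -> ~~ is_full b ->
  exists2 m, safe b m & row_blocked (write b m) r.
Proof.
move=> n6 qb gx g other nfull; have [lt|le] := ltnP (blocking_column x) n.
  have neS k : k != x -> look b r k != SomeS by move=> /g->; case: ifP.
  exists (r, Ordinal lt, LetterO); last exact: row_blocked_write_O n6 gx _.
  have [kx adj] := blocking_column_apart x.
  apply: safe_O => // [|i /= ei]; first by rewrite -look_ord /= g // lt.
  by split; apply: neS; lia.
have bl : row_blocked b r by apply: row_blocked_beyond le.
have [|m sm] := trap_free_safe_move qb nfull.
  apply/trappedP => -[r' [i]]; apply/negP/row_blocked_no_trap.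
  by have [->|/other] := eqVneq r' r.
by exists m => //; apply: row_blocked_write => //; case/andP: sm => /eqP.
Qed.

Lemma first_nonlosing n (hn : 0 < n) :
  n <= 6 -> exists s : strategy n, nonlosing_strategy First s.
Proof.
move=> n6; apply: (@careful_nonlosing n First (first_plan hn)).
apply: careful_strategy => // [h m K theirs qh /andP[_ /eqP bm]|h ph K mine no qh].
  case: h => [|m1 t] // in K theirs qh bm *; case/and3P: K => e r0 r1.
  rewrite -[rcons _ _]/(m1 :: rcons t m) /first_plan e -rcons_cons board_after_rcons.
  rewrite row_blocked_write //=; apply/implyP; rewrite size_rcons ltnS => t_gt0.
  apply: row_blocked_write => //; apply: (implyP r1).
  by move: theirs; rewrite /to_move /=; lia.
have nfull : ~~ is_full (board_after h) by case/norP: no.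
case: h => [|m1 [//|m2 t]] in ph K mine no qh nfull *.
  exists (first_opening hn); first exact: safe_opening.
  by rewrite /= eqxx row_blocked_opening.
case/and3P: K => e r0 r1.
suff [m sm bl1] : exists2 m, safe (board_after [:: m1, m2 & t]) m &
    row_blocked (write (board_after [:: m1, m2 & t]) m) ord_max.
  exists m => //; rewrite -[rcons _ _]/(m1 :: rcons (m2 :: t) m) /first_plan e.
  rewrite -rcons_cons board_after_rcons bl1 implybT row_blocked_write //.
  by case/andP: sm => /eqP.
have other r : r != ord_max -> row_blocked (board_after [:: m1, m2 & t]) r.
  by case: (row_cases r) => -> //.
case: t => [|m3 t] in ph mine no qh nfull r0 r1 other *; last first.
  have {}r1 := implyP r1 isT.
  have [|m sm] := trap_free_safe_move qh nfull.
    apply/trappedP => -[r [i]]; apply/negP/row_blocked_no_trap.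
    by case: (row_cases r) => ->.
  by exists m => //; apply: row_blocked_write => //; case/andP: sm => /eqP.
have row1 k : look (board_after [:: m1]) ord_max k = if k < n then None else SomeO.
  by rewrite (eqP e) -(look_empty n ord_max); apply: look_write_other.
have -> : board_after [:: m1; m2] = write (board_after [:: m1]) m2 by [].
case: m2 {ph mine no r0 r1} => [[r c] a] in qh nfull other *.
have [er|ne] := eqVneq ord_max r.
  apply: (@blocking_step _ _ _ c) => //; rewrite -er.
    by rewrite look_write upd_eq.
  by move=> k kc; rewrite look_write upd_neq // row1.
apply: (@blocking_step _ _ _ 0) => //; first by rewrite orbT.
by move=> k _; rewrite look_write_other.
Qed.

Theorem theorem12 (n : nat) (hn : 1 <= n) :
  (n < 7 -> is_draw n) /\ (7 <= n -> is_win_for n Second).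
Proof.
split=> [n6 []|]; [exact: first_nonlosing | exact: second_nonlosing |].
exact: second_wins.
Qed.
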